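(* Let $E,A\in\mathbb{R}^{m\times n}$, $B\in\mathbb{R}^{m\times k}$, $C\in\mathbb{R}^{p\times n}$, $D\in\mathbb{R}^{p\times k}$, $K\in\mathbb{R}^{r\times n}$, and consider the descriptor system $E\dot x(t)=Ax(t)+Bu(t)$, $y(t)=Cx(t)+Du(t)$, $z(t)=Kx(t)$. If there exists a generalized functional observer for this system of the form $$\dot w(t)=Nw(t)+H\begin{bmatrix}u(t)\\ y(t)\end{bmatrix},\qquad \hat z(t)=Rw(t)+\sum_{i=0}^{h-1}M_i\begin{bmatrix}u^{(i)}(t)\\ y^{(i)}(t)\end{bmatrix},$$ with $l,h\in\mathbb{N}_0$, $N\in\mathbb{R}^{l\times l}$, $H\in\mathbb{R}^{l\times(k+p)}$, $R\in\mathbb{R}^{r\times l}$, $M_i\in\mathbb{R}^{r\times(k+p)}$ for $i=0,\ldots,h-1$, then the descriptor system is partially detectable.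
   Context: No regularity or squareness is assumed: the coefficient matrices are arbitrary. Behavior. $\mathscr{B}$ is the set of all $(x,u,y,z)\in\mathscr{L}^1_{\mathrm{loc}}(\mathbb{R};\mathbb{R}^{n+k+p+r})$ such that $Ex\in\mathcal{AC}_{\mathrm{loc}}(\mathbb{R};\mathbb{R}^m)$ and $(x,u,y,z)$ satisfies the three system equations for almost all $t\in\mathbb{R}$ (with $E\dot x$ understood as $\frac{d}{dt}(Ex)$). Here $\mathscr{L}^1_{\mathrm{loc}}$ denotes the measurable, locally Lebesgue integrable functions and $\mathcal{AC}_{\mathrm{loc}}$ the locally absolutely continuous functions. It is assumed throughout that $\mathscr{B}$ is nonempty. Convergence. ''$f(t)\to 0$ as $t\to\infty$'' means $\lim_{t\to\infty}\operatorname{ess\,sup}_{[t,\infty)}\|f(t)\|=0$, i.e. the essential supremum of $\|f\|$ over $[t,\infty)$ tends to $0$. Partial detectability. The descriptor system is partially detectable if for all $(x_1,u,y,z_1),(x_2,u,y,z_2)\in\mathscr{B}$ one has $z_1(t)-z_2(t)\to 0$ as $t\to\infty$. Generalized functional observer. A system of the form displayed in the claim is a generalized functional observer for the descriptor system if for every $(x,u,y,z)\in\mathscr{B}$ there exist $w\in\mathcal{AC}_{\mathrm{loc}}(\mathbb{R};\mathbb{R}^l)$ and $\hat z\in\mathscr{L}^1_{\mathrm{loc}}(\mathbb{R};\mathbb{R}^r)$ such that $(w,u,y,\hat z)$ satisfies the two observer equations for almost all $t\in\mathbb{R}$, and for all $w,\hat z$ with this property: (a) $\hat z(t)-z(t)\to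 0$ as $t\to\infty$; (b) if $\hat z(0)=z(0)$, then $\hat z=z$ almost everywhere. Here $u^{(i)},y^{(i)}$ denote the $i$-th derivatives of $u,y$. *)

(* Defs.v *)
From HB Require Import structures.
From mathcomp Require Import all_boot all_order all_algebra.
From mathcomp Require Import all_classical all_reals all_analysis ess_sup_inf.

Set Implicit Arguments.
Unset Strict Implicit.
Unset Printing Implicit Defensive.

Import Order.TTheory GRing.Theory Num.Theory.
Import numFieldNormedType.Exports.

Local Open Scope classical_set_scope.
Local Open Scope ring_scope.

Section FunctionSpaces.
Context {R : realType}.

(* The complete Lebesgue measure is used, so that "measurable" below means
   Lebesgue measurable and not only Borel measurable. *)
Local Notation mu := (@completed_lebesgue_measure R).
Local Notation lebR := (caratheodory_type (wlength (idfun : R -> R))^*%mu).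

Definition L1loc_fun (f : R -> R) : Prop :=
  measurable_fun [set: lebR] (f : lebR -> R) /\
  forall K : set R, compact K -> mu.-integrable (K : set lebR) (EFin \o f).

Definition ac_on (a b : R) (f : R -> R) : Prop :=
  forall eps : R, 0 < eps -> exists2 delta : R, 0 < delta &
    forall (q : nat) (s t : 'I_q -> R),
      (forall i, a <= s i /\ s i <= t i /\ t i <= b) ->
      (forall i j, i != j -> t i <= s j \/ t j <= s i) ->
      \sum_(i < q) (t i - s i) < delta ->
      \sum_(i < q) `|f (t i) - f (s i)| < eps.

Definition ACloc_fun (f : R -> R) : Prop := forall a b : R, ac_on a b f.

Definition coord q (f : R -> 'cV[R]_q) (i : 'I_q) : R -> R :=
  fun t => f t i ord0.

Definition L1loc q (f : R -> 'cV[R]_q) : Prop :=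
  forall i, L1loc_fun (coord f i).

Definition ACloc q (f : R -> 'cV[R]_q) : Prop :=
  forall i, ACloc_fun (coord f i).

Definition has_deriv q (f : R -> 'cV[R]_q) (t : R) (v : 'cV[R]_q) : Prop :=
  forall i, is_derive t (1 : R) (coord f i) (v i ord0).

Definition enorm q (v : 'cV[R]_q) : R := Num.sqrt (\sum_i v i ord0 ^+ 2).

(* The restriction extends the norm by 0 outside [t, +oo[, which does not change
   the essential supremum, the norm being nonnegative. *)
Definition ess_tends_to0 q (f : R -> 'cV[R]_q) : Prop :=
  (fun t : R =>
     ess_sup mu ((fun s : lebR => (enorm (f s))%:E) \_ `[t, +oo[%classic))
    @ +oo --> 0%E.

Definition test_function (phi : R -> R) : Prop :=
  (forall (i : nat) (t : R), derivable (derive1n i phi) t 1) /\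
  exists c : R, forall t, c < `|t| -> phi t = 0.

(* g is \sum_(i < h) M_i v^(i), with v^(i) the i-th derivative of v in the sense
   of distributions.  A trajectory component is in general only locally
   integrable; the sum may be a function although the individual derivatives
   are not. *)
Definition is_deriv_comb h q r (M : 'I_h -> 'M[R]_(r, q))
    (v : R -> 'cV[R]_q) (g : R -> 'cV[R]_r) : Prop :=
  forall (j : 'I_r) (phi : R -> R), test_function phi ->
    \int[mu]_t (coord g j t * phi t) =
    \sum_(i < h) (-1) ^+ i *
      \int[mu]_t (coord (fun s => M i *m v s) j t * derive1n i phi t).

End FunctionSpaces.

Section Descriptor.
Context {R : realType} {m n k p r : nat}.
Local Notation mu := (@completed_lebesgue_measure R).

Variables (E A : 'M[R]_(m, n)) (B : 'M[R]_(m, k)) (C : 'M[R]_(p, n))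
  (D : 'M[R]_(p, k)) (K : 'M[R]_(r, n)).

Definition behavior : set ((R -> 'cV[R]_n) * (R -> 'cV[R]_k) *
                           (R -> 'cV[R]_p) * (R -> 'cV[R]_r)) :=
  [set tr | let: (x, u, y, z) := tr in
    [/\ [/\ L1loc x, L1loc u, L1loc y & L1loc z],
        ACloc (fun t => E *m x t) &
        {ae mu, forall t,
          [/\ has_deriv (fun s => E *m x s) t (A *m x t + B *m u t),
              y t = C *m x t + D *m u t &
              z t = K *m x t]}]].

Definition partially_detectable : Prop :=
  forall x1 x2 u y z1 z2,
    behavior (x1, u, y, z1) -> behavior (x2, u, y, z2) ->
    ess_tends_to0 (fun t => z1 t - z2 t).

Section Observer.
Context {l h : nat}.
Variables (N : 'M[R]_l) (H : 'M[R]_(l, k + p)) (Q : 'M[R]_(r, l))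
  (M : 'I_h -> 'M[R]_(r, k + p)).

Definition observer_trajectory (w : R -> 'cV[R]_l) (u : R -> 'cV[R]_k)
    (y : R -> 'cV[R]_p) (zh : R -> 'cV[R]_r) : Prop :=
  [/\ ACloc w, L1loc zh &
    exists g : R -> 'cV[R]_r,
      [/\ L1loc g, is_deriv_comb M (fun t => col_mx (u t) (y t)) g &
        {ae mu, forall t,
          has_deriv w t (N *m w t + H *m col_mx (u t) (y t)) /\
          zh t = Q *m w t + g t}]].

(* Changing zh at 0 alone preserves observer_trajectory, so in the last clause
   zh 0 = z 0 carries information only for representatives whose error is
   continuous at 0.  Dropping the continuity premise would make that clause force
   zh = z a.e. for all observer trajectories; such an observer satisfies the
   definition below as well. *)
Definition generalized_functional_observer : Prop :=
  forall x u y z, behavior (x, u, y, z) ->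
    (exists w zh, observer_trajectory w u y zh) /\
    forall w zh, observer_trajectory w u y zh ->
      ess_tends_to0 (fun t => zh t - z t) /\
      ((forall j, {for 0, continuous (coord (fun t => zh t - z t) j)}) ->
        zh 0 = z 0 -> {ae mu, forall t, zh t = z t}).

End Observer.
End Descriptor.

(* Main.v *)
Require Import Defs.
From mathcomp Require Import all_boot all_order all_algebra.
From mathcomp Require Import all_classical all_reals all_analysis.
From mathcomp Require Import ess_sup_inf lra.

Import Order.TTheory GRing.Theory Num.Theory.

Local Open Scope classical_set_scope.
Local Open Scope ring_scope.

(** An observer is driven by u and y alone, so an observer trajectory built for
    one behavior trajectory (x1, u, y, z1) is an observer trajectory for every
    (x2, u, y, z2) sharing the same input and output.  Its output zh therefore
    tracks z1 and z2 simultaneously, and z1 - z2 = (zh - z2) - (zh - z1) is a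
    difference of two functions that tend to 0.  What remains is that the
    essential limit used here is stable under differences, [ess_tends_to0B]. *)

(** The constant 2 is not optimal, but any constant serves in a limit at 0, and
    this one follows coordinatewise from (a - b)^2 <= 2 (a^2 + b^2), without
    the Cauchy-Schwarz inequality. *)
Lemma enormB_le (R : realType) q (v w : 'cV[R]_q) :
  enorm (v - w) <= 2 * (enorm v + enorm w).
Proof.
have sq_ge0 (a : 'cV[R]_q) : 0 <= \sum_i a i ord0 ^+ 2.
  by apply: sumr_ge0 => i _; rewrite sqr_ge0.
have e_ge0 (a : 'cV[R]_q) : 0 <= enorm a by rewrite sqrtr_ge0.
have eE (a : 'cV[R]_q) : enorm a ^+ 2 = \sum_i a i ord0 ^+ 2.
  by rewrite sqr_sqrtr.
rewrite -(ler_pXn2r (n := 2)) ?nnegrE ?mulr_ge0 ?addr_ge0 //.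
have : enorm (v - w) ^+ 2 <= 2 * (enorm v ^+ 2 + enorm w ^+ 2).
  rewrite !eE -big_split mulr_sumr; apply: ler_sum => i _ /=.
  by rewrite !mxE; have := sqr_ge0 (v i ord0 + w i ord0); nra.
by have := e_ge0 v; have := e_ge0 w; nra.
Qed.

Lemma completed_lebesgue_measureT_gt0 (R : realType) :
  (0 < @completed_lebesgue_measure R [set: R])%E.
Proof.
have : (0 < @lebesgue_measure R [set: R])%E.
  by rewrite -set_itvNyy lebesgue_measure_itv /= ltry.
(* Both measures are restrictions of the same outer measure. *)
by [].
Qed.

(** The upper bound is subadditivity of the essential supremum; the lower bound
    0 needs the measure to be nonzero, an essential supremum for the null
    measure being -oo. *)
Lemma ess_tends_to0B (R : realType) q (f g : R -> 'cV[R]_q) :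
  ess_tends_to0 f -> ess_tends_to0 g -> ess_tends_to0 (fun t => f t - g t).
Proof.
move=> f0 g0.
have fg0 := cvgeZl (y := 2%:E) isT (cvgeD (a := 0%E) (b := 0%E) isT f0 g0).
rewrite adde0 mule0 in fg0.
apply: squeeze_cvge (cvg_cst 0%E) (fg0 _); apply: nearW => t.
apply/andP; split.
  apply: ess_sup_gee; first exact: completed_lebesgue_measureT_gt0.
  apply: nearW => s; rewrite /patch; case: ifP => // _.
  by rewrite lee_fin sqrtr_ge0.
apply: le_trans (lee_wpmul2l _ (ess_supD _ _ _)) => //.
rewrite -ess_sup_pZl //; apply: le_ess_sup; apply: nearW => s.
rewrite /= /patch; case: ifP => _; last by rewrite adde0 mule0.
by rewrite -EFinD -EFinM lee_fin enormB_le.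
Qed.

Theorem theorem2 (R : realType) (m n k p r : nat)
  (E A : 'M[R]_(m, n)) (B : 'M[R]_(m, k)) (C : 'M[R]_(p, n))
  (D : 'M[R]_(p, k)) (K : 'M[R]_(r, n))
  (hne : behavior E A B C D K !=set0) :
  (exists (l h : nat) (N : 'M[R]_l) (H : 'M[R]_(l, k + p)) (Q : 'M[R]_(r, l))
     (M : 'I_h -> 'M[R]_(r, k + p)),
     generalized_functional_observer E A B C D K N H Q M) ->
  partially_detectable E A B C D K.
Proof.
move=> [l [h [N [H [Q [M obs]]]]]] x1 x2 u y z1 z2 b1 b2.
have [[w [zh tr]] tracks1] := obs _ _ _ _ b1.
have [zh_z1 _] := tracks1 _ _ tr.
have [_ tracks2] := obs _ _ _ _ b2.
have [zh_z2 _] := tracks2 _ _ tr.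
have -> : (fun t => z1 t - z2 t) = (fun t => (zh t - z2 t) - (zh t - z1 t)).
  by apply/funext => t; rewrite opprB [RHS]addrC addrA subrK.
exact: ess_tends_to0B.
Qed.
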